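(* Let $d=1/2$ and let $\varphi$ be the unique function in $C^3(0,d)\cap C^1[0,d]$ with $\varphi(\eta)>0$ for $0<\eta<d$ such that $\varphi(\eta)\varphi'''(\eta)=1$ for $0<\eta<d$, $\varphi(0)=\varphi(d)=0$ and $\varphi'(0)=1$. Then $$\frac{4\sqrt{2}}{3}\,\eta\,(d-\eta)^{3/2}\;\leqslant\;\varphi(\eta)\;\leqslant\;\frac{4\sqrt{6}}{3}\,\eta\,(d-\eta)^{3/2}\qquad\text{for all } \eta\in[0,d].$$
   Context: All functions are real-valued. $C^3(0,d)\cap C^1[0,d]$ denotes the functions that are three times continuously differentiable on $(0,d)$ and continuously differentiable up to the endpoints of $[0,d]$ (one-sided derivatives at the endpoints). Existence and uniqueness of $\varphi$ with the stated properties is a separate theorem of the paper and may be taken as known. *)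

(* Defs.v *)
From Stdlib Require Import Reals.
From Coquelicot Require Import Coquelicot.

Local Open Scope R_scope.

(* All k <= n are required: [ex_derive_n f n x] alone only says that
   [Derive_n f (n - 1)], which is total, is differentiable at x. *)
Definition Cn_open (n : nat) (a b : R) (f : R -> R) : Prop :=
  forall x : R, a < x < b ->
    (forall k : nat, (k <= n)%nat -> ex_derive_n f k x) /\
    continuous (Derive_n f n) x.

(* Derivative relative to [a, b], hence one-sided at a and b: the values of f
   outside [a, b] play no role. *)
Definition is_derive_on (a b : R) (f : R -> R) (x l : R) : Prop :=
  filterlim (fun y => (f y - f x) / (y - x))
    (within (fun y => a <= y <= b) (locally' x)) (locally l).

Definition C1_closed (a b : R) (f : R -> R) : Prop :=
  exists g : R -> R,
    (forall x : R, a <= x <= b -> is_derive_on a b f x (g x)) /\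
    continuous_on (fun x => a <= x <= b) g.

(* x^p for x >= 0 and p > 0. [Rpower] cannot be used at x = 0, since
   [Rpower 0 p = 1]. *)
Definition nonneg_power (x p : R) : R :=
  if Rlt_dec 0 x then Rpower x p else 0.

(* Main.v *)
(* Since (phi phi'' - phi'^2 / 2)' = phi phi''' = 1, and phi phi'' tends to 0
   and phi' to 1 at 0, the third-order equation integrates to
   phi phi'' - phi'^2 / 2 = x - 1 / 2 = - (d - x).
   With u = sqrt phi this reads u'' = - (d - x) / (2 u^3), whose right-hand
   side is increasing in u, so the maximum principle compares sub- and
   supersolutions that vanish at both ends. For the profile
   psi = A x s^(3/2), s = d - x, one finds
   psi psi'' - psi'^2 / 2 = - A^2 s (3/32 + 3/8 s - 5/8 s^2),
   and on [0, 1/2] the bracket lies between 3/32 and 3/20: A^2 = 32/3 makes psi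
   a supersolution and A^2 = 32/9 a subsolution. *)

Require Import Defs.
From Stdlib Require Import Reals Lra.
From Coquelicot Require Import Coquelicot.

Local Open Scope R_scope.

(** * Derivatives relative to an interval and one-sided limits *)

Lemma is_derive_on_eps (a b x l eps : R) (f : R -> R) :
  is_derive_on a b f x l -> 0 < eps ->
  exists delta : posreal, forall y : R, a <= y <= b -> y <> x ->
    Rabs (y - x) < delta -> Rabs ((f y - f x) / (y - x) - l) < eps.
Proof.
  intros H He.
  destruct (H (fun z => Rabs (z - l) < eps)) as [delta Hd].
  - exists (mkposreal eps He); intros z Hz; exact Hz.
  - exists delta; intros y Hy Hn Hb; exact (Hd y Hb Hn Hy).
Qed.

Lemma is_derive_on_interior (a b x l : R) (f : R -> R) :
  a < x < b -> is_derive_on a b f x l -> is_derive f x l.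
Proof.
  intros Hx H; apply is_derive_Reals; intros eps He.
  destruct (is_derive_on_eps _ _ _ _ _ _ H He) as [delta Hd].
  assert (Hm : 0 < Rmin delta (Rmin (x - a) (b - x))).
  { repeat apply Rmin_glb_lt; [apply cond_pos | lra | lra]. }
  exists (mkposreal _ Hm); intros h Hh0 Hh; simpl in Hh.
  assert (H1 := Rlt_le_trans _ _ _ Hh (Rmin_l _ _)).
  assert (H2 := Rlt_le_trans _ _ _ Hh (Rmin_r _ _)).
  assert (H3 := Rlt_le_trans _ _ _ H2 (Rmin_l _ _)).
  assert (H4 := Rlt_le_trans _ _ _ H2 (Rmin_r _ _)).
  apply Rabs_def2 in H3; apply Rabs_def2 in H4.
  assert (H5 := Hd (x + h)).
  replace (x + h - x) with h in H5 by ring.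
  apply H5; [lra | lra | exact H1].
Qed.

(** Write [f y] as [f x] plus the difference quotient times [y - x]: the quotient tends to [l] and
    the increment to 0. *)
Lemma is_derive_on_filterlim (a b x l : R) (f : R -> R) :
  is_derive_on a b f x l ->
  filterlim f (within (fun y => a <= y <= b) (locally' x)) (locally (f x)).
Proof.
  intros H.
  assert (Hid : filterlim (fun y => y - x)
      (within (fun y => a <= y <= b) (locally' x)) (locally (x - x))).
  { apply (filterlim_filter_le_1 _ (F := locally x)).
    - intros P HP; apply filter_imp with (2 := HP); tauto.
    - apply (continuous_minus (fun y => y) (fun _ => x));
        [apply continuous_id | apply continuous_const]. }
  apply (filterlim_ext_loc (fun y => f x + (f y - f x) / (y - x) * (y - x))).
  - exists (mkposreal 1 Rlt_0_1); intros y _ Hn _; field; lra.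
  - replace (locally (f x)) with (locally (f x + l * (x - x))) by (f_equal; ring).
    apply (filterlim_comp_2 (G := locally (f x)) (H := locally (l * (x - x))));
      [apply filterlim_const | | apply (filterlim_plus (f x) (l * (x - x)))].
    apply (filterlim_comp_2 (G := locally l) (H := locally (x - x)));
      [exact H | exact Hid | apply (filterlim_mult l (x - x))].
Qed.

Lemma at_right_le_within (a b : R) :
  a < b -> filter_le (at_right a) (within (fun y => a <= y <= b) (locally' a)).
Proof.
  intros Hab P [delta Hd].
  assert (Hm : 0 < Rmin delta (b - a)) by (apply Rmin_glb_lt; [apply cond_pos | lra]).
  exists (mkposreal _ Hm); intros y Hy Hay.
  change (Rabs (y - a) < Rmin delta (b - a)) in Hy.
  assert (H1 := Rmin_l delta (b - a)); assert (H2 := Rmin_r delta (b - a)).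
  rewrite Rabs_right in Hy by lra.
  apply Hd; [| lra | lra].
  change (Rabs (y - a) < delta); rewrite Rabs_right; lra.
Qed.

Lemma at_left_le_within (a b : R) :
  a < b -> filter_le (at_left b) (within (fun y => a <= y <= b) (locally' b)).
Proof.
  intros Hab P [delta Hd].
  assert (Hm : 0 < Rmin delta (b - a)) by (apply Rmin_glb_lt; [apply cond_pos | lra]).
  exists (mkposreal _ Hm); intros y Hy Hay.
  change (Rabs (y - b) < Rmin delta (b - a)) in Hy.
  assert (H1 := Rmin_l delta (b - a)); assert (H2 := Rmin_r delta (b - a)).
  rewrite Rabs_left in Hy by lra.
  apply Hd; [| lra | lra].
  change (Rabs (y - b) < delta); rewrite Rabs_left; lra.
Qed.

(** * Maximum principle on an open interval *)

Lemma increasing_of_derive_pos (a b : R) (w w1 : R -> R) :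
  a < b -> (forall y, a <= y <= b -> is_derive w y (w1 y)) ->
  (forall y, a < y < b -> 0 < w1 y) -> w a < w b.
Proof.
  intros Hab Hw Hp.
  destruct (MVT_cor2 w w1 a b Hab) as [c [Heq Hc]].
  - intros y Hy; apply is_derive_Reals, Hw, Hy.
  - specialize (Hp c Hc); nra.
Qed.

(** As [w1 x = 0], the quotient [w1 y / (y - x)] tends to [l > 0]; so [w1] is positive just to the
    right of [x], and [w] increases there. *)
Lemma no_local_max_of_second_derive_pos (a b x l : R) (w w1 : R -> R) :
  a < x < b -> (forall y, a < y < b -> is_derive w y (w1 y)) ->
  is_derive w1 x l -> 0 < l -> w1 x = 0 ->
  exists y : R, a < y < b /\ w x < w y.
Proof.
  intros Hx Hw Hw1 Hl H0.
  apply is_derive_Reals in Hw1.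
  destruct (Hw1 l Hl) as [delta Hd].
  assert (Hm : 0 < Rmin delta (b - x)) by (apply Rmin_glb_lt; [apply cond_pos | lra]).
  assert (Hm1 := Rmin_l delta (b - x)); assert (Hm2 := Rmin_r delta (b - x)).
  set (h := Rmin delta (b - x) / 2).
  assert (Hh : 0 < h < delta /\ x + h < b) by (unfold h; lra).
  exists (x + h); split; [lra |].
  apply increasing_of_derive_pos with w1; [lra | intros y Hy; apply Hw; lra |].
  intros y Hy.
  assert (Hq := Hd (y - x)).
  replace (x + (y - x)) with y in Hq by ring.
  rewrite H0, Rminus_0_r in Hq.
  assert (Hq' : Rabs (w1 y / (y - x) - l) < l).
  { apply Hq; [lra | rewrite Rabs_right; lra]. }
  apply Rabs_def2 in Hq'.
  replace (w1 y) with (w1 y / (y - x) * (y - x)) by (field; lra).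
  apply Rmult_lt_0_compat; lra.
Qed.

(** A positive value would force a positive interior maximum, where [w1] vanishes and [w2] is
    positive, which is impossible. The conditions at the ends say that the upper limits of [w] are
    at most 0. *)
Lemma maximum_principle (a b : R) (w w1 w2 : R -> R) :
  (forall x, a < x < b -> is_derive w x (w1 x)) ->
  (forall x, a < x < b -> is_derive w1 x (w2 x)) ->
  (forall x, a < x < b -> 0 < w x -> 0 < w2 x) ->
  (forall eps, 0 < eps -> at_right a (fun x => a < x < b -> w x < eps)) ->
  (forall eps, 0 < eps -> at_left b (fun x => a < x < b -> w x < eps)) ->
  forall x, a < x < b -> w x <= 0.
Proof.
  intros Hw Hw1 Hw2 Ha Hb x Hx.
  apply Rnot_lt_le; intros Hpos.
  destruct (Ha _ Hpos) as [da Hda]; destruct (Hb _ Hpos) as [db Hdb].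
  assert (Hda0 := cond_pos da); assert (Hdb0 := cond_pos db).
  (* Points [p] and [q] near the ends, with values below [w x], give a compact interval inside
     [(a, b)] on which the maximum is not attained at an endpoint. *)
  assert (Hleft : exists p, a < p < x /\ w p < w x).
  { exists (a + Rmin da (x - a) / 2).
    assert (H0 : 0 < Rmin da (x - a)) by (apply Rmin_glb_lt; lra).
    assert (H1 := Rmin_l da (x - a)); assert (H2 := Rmin_r da (x - a)).
    split; [lra |]; apply Hda; [| lra | lra].
    apply Rabs_lt_between'; lra. }
  assert (Hright : exists q, x < q < b /\ w q < w x).
  { exists (b - Rmin db (b - x) / 2).
    assert (H0 : 0 < Rmin db (b - x)) by (apply Rmin_glb_lt; lra).
    assert (H1 := Rmin_l db (b - x)); assert (H2 := Rmin_r db (b - x)).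
    split; [lra |]; apply Hdb; [| lra | lra].
    apply Rabs_lt_between'; lra. }
  destruct Hleft as [p [Hp Hwp]]; destruct Hright as [q [Hq Hwq]].
  destruct (continuity_ab_maj w p q) as [m [Hmax Hm]]; [lra | |].
  { intros y Hy; apply continuity_pt_filterlim.
    apply (ex_derive_continuous w y); exists (w1 y); apply Hw; lra. }
  assert (Hxm : w x <= w m) by (apply Hmax; lra).
  assert (Hpm : p < m) by (destruct (Req_dec p m) as [<- |]; lra).
  assert (Hqm : m < q) by (destruct (Req_dec m q) as [-> |]; lra).
  assert (Hm1 : w1 m = 0).
  { assert (Hdm : derivable_pt_lim w m (w1 m)) by (apply is_derive_Reals, Hw; lra).
    change (derive_pt w m (exist _ _ Hdm) = 0).
    apply deriv_maximum with p q; [lra | lra | intros y H1 H2; apply Hmax; lra]. }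
  destruct (no_local_max_of_second_derive_pos p q m (w2 m) w w1) as [y [Hy Hwy]].
  - lra.
  - intros y Hy; apply Hw; lra.
  - apply Hw1; lra.
  - apply Hw2; lra.
  - exact Hm1.
  - assert (H := Hmax y ltac:(lra)); lra.
Qed.

(** * Square-root substitution and comparison of sub- and supersolutions *)

Lemma is_derive_sqrt_comp (f : R -> R) (x l : R) :
  0 < f x -> is_derive f x l ->
  is_derive (fun y => sqrt (f y)) x (l / (2 * sqrt (f x))).
Proof.
  intros Hf H.
  assert (Hs := sqrt_lt_R0 _ Hf).
  evar_last; [apply (is_derive_comp sqrt f x); [apply is_derive_Reals, derivable_pt_lim_sqrt, Hf | exact H] |].
  unfold scal; simpl; unfold mult; simpl; field; lra.
Qed.

Lemma is_derive_sqrt_comp2 (f f1 : R -> R) (x l : R) :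
  0 < f x -> is_derive f x (f1 x) -> is_derive f1 x l ->
  is_derive (fun y => f1 y / (2 * sqrt (f y))) x
    ((f x * l - f1 x ^ 2 / 2) / (2 * sqrt (f x) ^ 3)).
Proof.
  intros Hf H H1.
  assert (Hs := sqrt_lt_R0 _ Hf).
  assert (Hss := sqrt_sqrt _ (Rlt_le _ _ Hf)).
  evar_last.
  - apply (is_derive_div f1 (fun y => 2 * sqrt (f y)) x); [exact H1 | | lra].
    apply is_derive_scal, is_derive_sqrt_comp; [exact Hf | exact H].
  (* Replacing [f x] by [s * s] leaves a rational identity in [s]. *)
  - set (s := sqrt (f x)) in *; rewrite <- Hss.
    unfold scal; simpl; unfold mult; simpl; field; lra.
Qed.

(* [phi phi'' - phi'^2 / 2 = 2 u^3 u''] for [u = sqrt phi], see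
   [is_derive_sqrt_comp2]; the comparison takes place at a maximum of
   [sqrt phi - sqrt psi]. *)
Lemma first_integral_comparison (a b : R) (h phi phi1 phi2 psi psi1 psi2 : R -> R) :
  (forall x, a < x < b -> 0 < h x) ->
  (forall x, a < x < b -> 0 < phi x) ->
  (forall x, a < x < b -> 0 < psi x) ->
  (forall x, a < x < b -> is_derive phi x (phi1 x)) ->
  (forall x, a < x < b -> is_derive phi1 x (phi2 x)) ->
  (forall x, a < x < b -> is_derive psi x (psi1 x)) ->
  (forall x, a < x < b -> is_derive psi1 x (psi2 x)) ->
  (forall x, a < x < b -> - h x <= phi x * phi2 x - phi1 x ^ 2 / 2) ->
  (forall x, a < x < b -> psi x * psi2 x - psi1 x ^ 2 / 2 <= - h x) ->
  filterlim phi (at_right a) (locally 0) ->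
  filterlim phi (at_left b) (locally 0) ->
  forall x, a < x < b -> phi x <= psi x.
Proof.
  intros Hh Hphi Hpsi Dphi Dphi1 Dpsi Dpsi1 Sphi Spsi La Lb.
  (* Since [sqrt (psi x) >= 0], the bound [phi x < eps ^ 2] already controls the difference of the
     roots. *)
  assert (Hend : forall eps x, 0 < eps -> a < x < b -> ball 0 (eps ^ 2) (phi x) ->
                 sqrt (phi x) - sqrt (psi x) < eps).
  { intros eps x He Hx Hball.
    change (Rabs (phi x - 0) < eps ^ 2) in Hball; apply Rabs_def2 in Hball.
    assert (H1 : sqrt (phi x) < sqrt (eps ^ 2)).
    { apply sqrt_lt_1_alt; split; [apply Rlt_le, Hphi, Hx | lra]. }
    rewrite sqrt_pow2 in H1 by lra.
    assert (H2 := sqrt_pos (psi x)); lra. }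
  intros x Hx.
  apply sqrt_le_0; [apply Rlt_le, Hphi, Hx | apply Rlt_le, Hpsi, Hx |].
  apply Rminus_le.
  apply (maximum_principle a b (fun y => sqrt (phi y) - sqrt (psi y))
    (fun y => phi1 y / (2 * sqrt (phi y)) - psi1 y / (2 * sqrt (psi y)))
    (fun y => (phi y * phi2 y - phi1 y ^ 2 / 2) / (2 * sqrt (phi y) ^ 3)
            - (psi y * psi2 y - psi1 y ^ 2 / 2) / (2 * sqrt (psi y) ^ 3))); [| | | | | exact Hx].
  - intros y Hy; apply (is_derive_minus (fun y => sqrt (phi y)) (fun y => sqrt (psi y)));
      apply is_derive_sqrt_comp; auto.
  - intros y Hy.
    apply (is_derive_minus (fun y => phi1 y / (2 * sqrt (phi y)))
                           (fun y => psi1 y / (2 * sqrt (psi y))));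
      apply is_derive_sqrt_comp2; auto.
  - intros y Hy Hlt.
    assert (Hs := sqrt_lt_R0 _ (Hpsi y Hy)).
    assert (Hc : sqrt (psi y) ^ 3 < sqrt (phi y) ^ 3).
    { assert (0 < (sqrt (phi y) - sqrt (psi y)) *
        (sqrt (phi y) ^ 2 + sqrt (phi y) * sqrt (psi y) + sqrt (psi y) ^ 2)); [| lra].
      apply Rmult_lt_0_compat; nra. }
    assert (Hc0 : 0 < sqrt (psi y) ^ 3) by (apply pow_lt, Hs).
    assert (H1 := Sphi y Hy); assert (H2 := Spsi y Hy); assert (H3 := Hh y Hy).
    set (U := sqrt (phi y) ^ 3) in *; set (V := sqrt (psi y) ^ 3) in *.
    set (A := phi y * phi2 y - phi1 y ^ 2 / 2) in *.
    set (B := psi y * psi2 y - psi1 y ^ 2 / 2) in *.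
    (* From [A >= - h y], [B <= - h y] and [0 < V < U], the numerator is at least
       [h y * (U - V) > 0]. *)
    replace (A / (2 * U) - B / (2 * V)) with ((A * V - B * U) / (2 * U * V)) by (field; lra).
    apply Rdiv_lt_0_compat; nra.
  - intros eps He.
    assert (He2 : 0 < eps ^ 2) by (apply pow_lt, He).
    assert (HL := proj1 (filterlim_locally _ _) La (mkposreal _ He2)).
    revert HL; apply filter_imp; intros y Hy Hab; now apply Hend.
  - intros eps He.
    assert (He2 : 0 < eps ^ 2) by (apply pow_lt, He).
    assert (HL := proj1 (filterlim_locally _ _) Lb (mkposreal _ He2)).
    revert HL; apply filter_imp; intros y Hy Hab; now apply Hend.
Qed.


(** * The first integral and its constant *)

(** The continuous derivative [g] on [[a, b]] agrees with [f1] inside and, by uniqueness of limits,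
    with [l] at [a]; so [f1] inherits the limit of [g]. *)
Lemma derive_at_right (a b l : R) (f f1 : R -> R) :
  a < b -> C1_closed a b f -> is_derive_on a b f a l ->
  (forall x, a < x < b -> is_derive f x (f1 x)) ->
  filterlim f1 (at_right a) (locally l).
Proof.
  intros Hab [g [Hg Cg]] Hl Hf1.
  assert (Hga : g a = l).
  { apply (filterlim_locally_unique (F := at_right a) (fun y => (f y - f a) / (y - a)));
      apply (filterlim_filter_le_1 _ (at_right_le_within a b Hab));
      [apply (Hg a); lra | exact Hl]. }
  rewrite <- Hga.
  apply (filterlim_ext_loc g).
  - exists (mkposreal (b - a) (proj2 (Rlt_0_minus _ _) Hab)).
    intros y Hy Hay; change (Rabs (y - a) < b - a) in Hy; apply Rabs_def2 in Hy.
    rewrite <- (is_derive_unique f y (f1 y)) by (apply Hf1; lra).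
    symmetry; apply is_derive_unique, is_derive_on_interior with a b; [lra |].
    apply Hg; lra.
  - apply (filterlim_filter_le_1 _ (F := within (fun y => a <= y <= b) (locally a))).
    + intros P HP; apply at_right_le_within with b; [exact Hab |].
      unfold within, locally' in *; apply filter_imp with (2 := HP); tauto.
    + apply Cg; lra.
Qed.

(* If [k <> 0], then [phi2 x] is of size at least [k / (4 x)] near [0], so that
   [phi1] oscillates by about [k / 8] on [[x, 2 x]]. *)
Lemma limit_mul_second_derive (b k : R) (phi phi1 phi2 : R -> R) :
  0 < b ->
  (forall x, 0 < x < b -> 0 < phi x) ->
  (forall x, 0 < x < b -> is_derive phi1 x (phi2 x)) ->
  filterlim (fun x => phi x / x) (at_right 0) (locally 1) ->
  filterlim phi1 (at_right 0) (locally 1) ->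
  filterlim (fun x => phi x * phi2 x) (at_right 0) (locally k) ->
  k = 0.
Proof.
  intros Hb Hpos Dphi1 L0 L1 Lk.
  destruct (Req_dec k 0) as [| Hk]; [assumption | exfalso].
  assert (Hk0 : 0 < Rabs k) by now apply Rabs_pos_lt.
  assert (Hk1 : 0 < Rabs k / 2) by lra.
  assert (Hk2 : 0 < Rabs k / 16) by lra.
  assert (E0 := proj1 (filterlim_locally _ _) L0 (mkposreal _ Rlt_0_1)).
  assert (E1 := proj1 (filterlim_locally _ _) L1 (mkposreal _ Hk2)).
  assert (E2 := proj1 (filterlim_locally _ _) Lk (mkposreal _ Hk1)).
  destruct (filter_and _ _ E0 (filter_and _ _ E1 E2)) as [delta Hd].
  assert (Hm : 0 < Rmin delta b) by (apply Rmin_glb_lt; [apply cond_pos | lra]).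
  assert (Hm1 := Rmin_l delta b); assert (Hm2 := Rmin_r delta b).
  (* Dividing by 3 keeps all of [[x, 2 * x]] within [delta] of 0 and below [b]. *)
  set (x := Rmin delta b / 3).
  assert (Hx : 0 < x /\ 2 * x < delta /\ 2 * x < b) by (unfold x; lra).
  assert (Hnear : forall y, 0 < y <= 2 * x ->
    Rabs (phi y / y - 1) < 1 /\ Rabs (phi1 y - 1) < Rabs k / 16 /\
    Rabs (phi y * phi2 y - k) < Rabs k / 2).
  { intros y Hy; apply Hd; [| lra].
    change (Rabs (y - 0) < delta); rewrite Rabs_right; lra. }
  destruct (MVT_cor2 phi1 phi2 x (2 * x)) as [c [Heq Hc]]; [lra | |].
  { intros y Hy; apply is_derive_Reals, Dphi1; lra. }
  destruct (Hnear x) as [_ [H1 _]]; [lra |].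
  destruct (Hnear (2 * x)) as [_ [H2 _]]; [lra |].
  destruct (Hnear c) as [H3 [_ H4]]; [lra |].
  assert (Hphi : 0 < phi c) by (apply Hpos; lra).
  (* With [c < 2 * x] this gives [phi c < 4 * x], so the increment [x * Rabs (phi2 c)] of [phi1]
     exceeds [Rabs k / 8], whereas two deviations below [Rabs k / 16] keep it under that value. *)
  assert (Hphi2 : phi c < 2 * c).
  { apply Rabs_def2 in H3.
    replace (phi c) with (phi c / c * c) by (field; lra); nra. }
  assert (H5 : Rabs k / 2 < phi c * Rabs (phi2 c)).
  { rewrite <- (Rabs_right (phi c)) at 1 by lra; rewrite <- Rabs_mult.
    assert (H := Rabs_triang (phi c * phi2 c) (k - phi c * phi2 c)).
    rewrite (Rabs_minus_sym k) in H.
    replace (phi c * phi2 c + (k - phi c * phi2 c)) with k in H by ring; lra. }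
  assert (H6 : Rabs (phi1 (2 * x) - phi1 x) < Rabs k / 8).
  { apply Rabs_def2 in H1; apply Rabs_def2 in H2; apply Rabs_def1; lra. }
  rewrite Heq, Rabs_mult, (Rabs_right (2 * x - x)) in H6 by lra.
  assert (H7 := Rabs_pos (phi2 c)).
  assert (H8 : phi c * Rabs (phi2 c) <= 4 * x * Rabs (phi2 c))
    by (apply Rmult_le_compat_r; lra).
  lra.
Qed.

(** The difference [Q] of the left side and [x] has derivative 0, hence is a constant [c]. Near 0
    this makes [phi phi''] tend to [c + 1 / 2], a limit that must vanish by
    [limit_mul_second_derive]. *)
Lemma first_integral (d : R) (phi : R -> R) :
  0 < d -> Cn_open 3 0 d phi -> C1_closed 0 d phi ->
  (forall x, 0 < x < d -> 0 < phi x) ->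
  (forall x, 0 < x < d -> phi x * Derive_n phi 3 x = 1) ->
  phi 0 = 0 -> is_derive_on 0 d phi 0 1 ->
  forall x, 0 < x < d ->
    phi x * Derive_n phi 2 x - Derive_n phi 1 x ^ 2 / 2 = x - 1 / 2.
Proof.
  intros Hd H3 H1 Hpos Hode H0 Hd0.
  assert (D : forall k x, (k < 3)%nat -> 0 < x < d ->
    is_derive (Derive_n phi k) x (Derive_n phi (S k) x)).
  { intros k x Hk Hx; apply Derive_correct; exact (proj1 (H3 x Hx) (S k) Hk). }
  assert (D0 := fun x => D 0%nat x ltac:(auto)).
  assert (D1 := fun x => D 1%nat x ltac:(auto)).
  assert (D2 := fun x => D 2%nat x ltac:(auto)).
  set (Q := fun x => phi x * Derive_n phi 2 x - Derive_n phi 1 x ^ 2 / 2 - x).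
  assert (DQ : forall x, 0 < x < d -> is_derive Q x 0).
  { intros x Hx.
    assert (E := Hode x Hx).
    evar_last.
    - apply (is_derive_minus (fun y => phi y * Derive_n phi 2 y - Derive_n phi 1 y ^ 2 / 2)
        (fun y => y)); [| apply is_derive_id].
      apply (is_derive_minus (fun y => phi y * Derive_n phi 2 y)
        (fun y => Derive_n phi 1 y ^ 2 / 2)).
      + apply (is_derive_mult phi (Derive_n phi 2));
          [exact (D0 x Hx) | exact (D2 x Hx) | intros; apply Rmult_comm].
      + apply (is_derive_ext (fun y => / 2 * Derive_n phi 1 y ^ 2));
          [intros; simpl; field |].
        apply is_derive_scal, (is_derive_pow (Derive_n phi 1) 2), (D1 x Hx).
    - unfold minus, plus, opp, mult, one; simpl.
      unfold mult; simpl.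
      simpl in E; rewrite E; field. }
  assert (CQ : forall x y, 0 < x < y -> y < d -> Q x = Q y).
  { intros x y Hx Hy; apply (eq_is_derive Q); [| lra].
    intros t Ht; apply DQ; lra. }
  set (c := Q (d / 2)).
  assert (CQ' : forall x, 0 < x < d -> Q x = c).
  { intros x Hx; destruct (Rtotal_order x (d / 2)) as [H | [-> | H]].
    - apply CQ; lra.
    - reflexivity.
    - symmetry; apply CQ; lra. }
  assert (L1 : filterlim (Derive_n phi 1) (at_right 0) (locally 1)).
  { exact (derive_at_right 0 d 1 phi _ Hd H1 Hd0 D0). }
  assert (Hc : c + 1 / 2 = 0).
  { apply (limit_mul_second_derive d (c + 1 / 2) phi (Derive_n phi 1) (Derive_n phi 2)).
    - exact Hd.
    - exact Hpos.
    - exact D1.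
    - apply (filterlim_ext (fun y => (phi y - phi 0) / (y - 0))).
      { intros y; now rewrite H0, !Rminus_0_r. }
      apply (filterlim_filter_le_1 _ (at_right_le_within 0 d Hd)), Hd0.
    - exact L1.
    (* This is [Q y = c] solved for [phi phi'']. *)
    - apply (filterlim_ext_loc (fun y => (c + y) + Derive_n phi 1 y ^ 2 / 2)).
      + exists (mkposreal d Hd); intros y Hy Hy0.
        change (Rabs (y - 0) < d) in Hy; apply Rabs_def2 in Hy.
        rewrite <- (CQ' y) by lra; unfold Q; field.
      + replace (c + 1 / 2) with ((c + 0) + 1 ^ 2 / 2) by field.
        apply (filterlim_comp_2 (G := locally (c + 0)) (H := locally (1 ^ 2 / 2)));
          [| | apply (filterlim_plus (c + 0) (1 ^ 2 / 2))].
        * apply (filterlim_filter_le_1 _ (F := locally 0)).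
          { apply filter_le_within. }
          apply (continuous_plus (fun _ => c) (fun y => y));
            [apply continuous_const | apply continuous_id].
        * apply (filterlim_comp _ _ _ (Derive_n phi 1) (fun z => z ^ 2 / 2) _ (locally 1));
            [exact L1 |].
          apply (ex_derive_continuous (fun z => z ^ 2 / 2) 1); auto_derive; auto. }
  intros x Hx.
  assert (E := CQ' x Hx); unfold Q in E; lra.
Qed.

(** * The explicit profile [A x (d - x)^(3/2)] *)

Lemma nonneg_power_3_2 (s : R) : 0 <= s -> nonneg_power s (3 / 2) = s * sqrt s.
Proof.
  intros Hs; unfold nonneg_power; destruct (Rlt_dec 0 s) as [H | H].
  - replace (3 / 2) with (1 + / 2) by field.
    now rewrite Rpower_plus, Rpower_1, Rpower_sqrt.
  - replace s with 0 by lra; ring.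
Qed.

Lemma is_derive_profile (A d x : R) :
  x < d ->
  is_derive (fun y => A * y * ((d - y) * sqrt (d - y))) x
    (A * ((d - x) * sqrt (d - x) - 3 / 2 * x * sqrt (d - x))).
Proof.
  intros Hx.
  assert (Hs : 0 < sqrt (d - x)) by (apply sqrt_lt_R0; lra).
  assert (Hss : sqrt (d - x) * sqrt (d - x) = d - x) by (apply sqrt_sqrt; lra).
  auto_derive; [lra |].
  unfold Rminus in *; set (s := sqrt (d + - x)) in *.
  replace d with (s * s + x) by lra; field; lra.
Qed.

Lemma is_derive_profile2 (A d x : R) :
  x < d ->
  is_derive (fun y => A * ((d - y) * sqrt (d - y) - 3 / 2 * y * sqrt (d - y))) x
    (A * (3 / 4 * x / sqrt (d - x) - 3 * sqrt (d - x))).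
Proof.
  intros Hx.
  assert (Hs : 0 < sqrt (d - x)) by (apply sqrt_lt_R0; lra).
  assert (Hss : sqrt (d - x) * sqrt (d - x) = d - x) by (apply sqrt_sqrt; lra).
  auto_derive; [lra |].
  unfold Rminus in *; set (s := sqrt (d + - x)) in *.
  replace d with (s * s + x) by lra; field; lra.
Qed.

(** The left side is [psi psi'' - psi'^2 / 2] for the profile with [d = 1 / 2]. Pulling out
    [s = d - x] reduces both comparisons to setting [A ^ 2] times the bracket against 1. *)
Lemma profile_first_integral (A x : R) :
  x < 1 / 2 ->
  let s := 1 / 2 - x in
  A * x * (s * sqrt s) * (A * (3 / 4 * x / sqrt s - 3 * sqrt s))
    - (A * (s * sqrt s - 3 / 2 * x * sqrt s)) ^ 2 / 2
  = - (A ^ 2 * (3 / 32 + 3 / 8 * s - 5 / 8 * s ^ 2) * s).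
Proof.
  intros Hx s.
  assert (Hs : 0 < sqrt s) by (apply sqrt_lt_R0; unfold s; lra).
  assert (Hss : sqrt s * sqrt s = s) by (apply sqrt_sqrt; unfold s; lra).
  replace x with (1 / 2 - s) by (unfold s; ring).
  set (r := sqrt s) in *; clearbody r s; subst s; field; lra.
Qed.

Lemma filterlim_profile (A d x : R) (D : R -> Prop) :
  x = 0 \/ x = d ->
  filterlim (fun y => A * y * ((d - y) * sqrt (d - y))) (within D (locally x)) (locally 0).
Proof.
  intros Hx; apply (filterlim_filter_le_1 _ (F := locally x)); [apply filter_le_within |].
  replace 0 with (A * x * ((d - x) * sqrt (d - x)))
    by (destruct Hx as [-> | ->]; ring).
  apply (continuous_mult (fun y => A * y) (fun y => (d - y) * sqrt (d - y))).
  - apply (ex_derive_continuous (fun y => A * y) x); auto_derive; auto.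
  - assert (Hd : continuous (fun y => d - y) x)
      by (apply (ex_derive_continuous (fun y => d - y) x); auto_derive; auto).
    apply (continuous_mult (fun y => d - y) (fun y => sqrt (d - y))); [exact Hd |].
    (* [sqrt] is 0 on negative reals, hence continuous everywhere, even at [x = d] where [d - y]
       changes sign. *)
    apply (continuous_comp (fun y => d - y) sqrt); [exact Hd | apply continuous_sqrt].
Qed.

(** * Comparison of [phi] with the two profiles *)

Theorem theorem2 (d : R) (phi : R -> R)
  (hd : d = 1 / 2)
  (hC3 : Cn_open 3 0 d phi)
  (hC1 : C1_closed 0 d phi)
  (hpos : forall eta : R, 0 < eta < d -> 0 < phi eta)
  (hode : forall eta : R, 0 < eta < d -> phi eta * Derive_n phi 3 eta = 1)
  (hphi0 : phi 0 = 0)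
  (hphid : phi d = 0)
  (hphi0' : is_derive_on 0 d phi 0 1) :
  forall eta : R, 0 <= eta <= d ->
    4 * sqrt 2 / 3 * eta * nonneg_power (d - eta) (3 / 2) <= phi eta /\
    phi eta <= 4 * sqrt 6 / 3 * eta * nonneg_power (d - eta) (3 / 2).
Proof.
  intros eta Heta.
  rewrite nonneg_power_3_2 by lra.
  (* The comparison covers the open interval; at each endpoint all three terms vanish. *)
  destruct (Req_dec eta 0) as [-> | Hn0]; [rewrite hphi0; lra |].
  destruct (Req_dec eta d) as [-> | Hnd]; [rewrite hphid; lra |].
  assert (Hd : 0 < d) by lra.
  assert (HQ := first_integral d phi Hd hC3 hC1 hpos hode hphi0 hphi0').
  assert (D0 : forall x, 0 < x < d -> is_derive phi x (Derive_n phi 1 x))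
    by (intros x Hx; apply Derive_correct; exact (proj1 (hC3 x Hx) 1%nat ltac:(auto))).
  assert (D1 : forall x, 0 < x < d -> is_derive (Derive_n phi 1) x (Derive_n phi 2 x))
    by (intros x Hx; apply Derive_correct; exact (proj1 (hC3 x Hx) 2%nat ltac:(auto))).
  assert (Ppos : forall A x, 0 < A -> 0 < x < d -> 0 < A * x * ((d - x) * sqrt (d - x))).
  { intros A x HA Hx; assert (0 < sqrt (d - x)) by (apply sqrt_lt_R0; lra).
    repeat apply Rmult_lt_0_compat; lra. }
  split.
  - assert (HA : 0 < sqrt 2) by (apply sqrt_lt_R0; lra).
    assert (HA2 : sqrt 2 * sqrt 2 = 2) by (apply sqrt_sqrt; lra).
    (* Lower bound: the profile is the subsolution, and [phi] satisfies the first integral with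
       equality, as [x - 1 / 2 = - (d - x)]. *)
    apply (first_integral_comparison 0 d (fun x => d - x) _
      (fun x => 4 * sqrt 2 / 3 * ((d - x) * sqrt (d - x) - 3 / 2 * x * sqrt (d - x)))
      (fun x => 4 * sqrt 2 / 3 * (3 / 4 * x / sqrt (d - x) - 3 * sqrt (d - x)))
      phi (Derive_n phi 1) (Derive_n phi 2)
      ltac:(intros; lra) (fun x => Ppos (4 * sqrt 2 / 3) x ltac:(lra)) hpos); try assumption.
    + intros x Hx; apply is_derive_profile; lra.
    + intros x Hx; apply is_derive_profile2; lra.
    + intros x Hx; rewrite hd in *; rewrite profile_first_integral by lra.
      replace ((4 * sqrt 2 / 3) ^ 2) with (32 / 9) by (simpl; nra).
      (* [3 / 32 + 3 / 8 s - 5 / 8 s ^ 2] is maximal at [s = 3 / 10]. *)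
      assert (0 <= (1 / 2 - x - 3 / 10) ^ 2) by apply pow2_ge_0; nra.
    + intros x Hx; rewrite HQ by assumption; lra.
    + apply filterlim_profile; auto.
    + apply filterlim_profile; auto.
    + lra.
  - assert (HA : 0 < sqrt 6) by (apply sqrt_lt_R0; lra).
    assert (HA2 : sqrt 6 * sqrt 6 = 6) by (apply sqrt_sqrt; lra).
    (* Upper bound: the roles are exchanged, so the limits at the ends now concern [phi]. *)
    apply (first_integral_comparison 0 d (fun x => d - x)
      phi (Derive_n phi 1) (Derive_n phi 2)
      (fun x => 4 * sqrt 6 / 3 * x * ((d - x) * sqrt (d - x)))
      (fun x => 4 * sqrt 6 / 3 * ((d - x) * sqrt (d - x) - 3 / 2 * x * sqrt (d - x)))
      (fun x => 4 * sqrt 6 / 3 * (3 / 4 * x / sqrt (d - x) - 3 * sqrt (d - x)))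
      ltac:(intros; lra) hpos (fun x => Ppos (4 * sqrt 6 / 3) x ltac:(lra))); try assumption.
    + intros x Hx; apply is_derive_profile; lra.
    + intros x Hx; apply is_derive_profile2; lra.
    + intros x Hx; rewrite HQ by assumption; lra.
    + intros x Hx; rewrite hd in *; rewrite profile_first_integral by lra.
      replace ((4 * sqrt 6 / 3) ^ 2) with (32 / 3) by (simpl; nra).
      (* With [s = 1 / 2 - x], the required inequality has slack [2 / 3 * s ^ 2 * (1 + 10 * x)]. *)
      assert (0 <= (1 / 2 - x) ^ 2 * x) by (apply Rmult_le_pos; [apply pow2_ge_0 | lra]).
      nra.
    (* At both ends, differentiability relative to [[0, d]] yields one-sided continuity. *)
    + replace (locally 0) with (locally (phi 0)) by now rewrite hphi0.
      apply (filterlim_filter_le_1 _ (at_right_le_within 0 d Hd)).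
      exact (is_derive_on_filterlim 0 d 0 1 phi hphi0').
    + replace (locally 0) with (locally (phi d)) by now rewrite hphid.
      destruct hC1 as [g [Hg _]].
      apply (filterlim_filter_le_1 _ (at_left_le_within 0 d Hd)).
      exact (is_derive_on_filterlim 0 d d (g d) phi (Hg d ltac:(lra))).
    + lra.
Qed.
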